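(* Let $X$ be a random variable taking values in $\mathbb{Z}_+=\{0,1,2,\dots\}$ with probability mass function $p_X(i)=\mathbb{P}(X=i)$. 1. Let $p\in(0,1)$. If $p_X(i+1)/p_X(i)\le p$ for all $i\ge 1$ (meaning $p_X(i+1)\le p\,p_X(i)$ for all $i\ge1$), then $X\in\mathcal{C}_{\mathrm{Geom}(p)}$. 2. If there is a gap in the support of $X$, that is, if for some $i\ge 1$ we have $p_X(i)=0$ but $p_X(i-1)>0$ and $p_X(i+1)>0$, then $X\notin\mathcal{C}_{\mathrm{Geom}(p)}$ for any $p\in(0,1)$.
   Context: For $p\in(0,1)$, $\mathrm{Geom}(p)$ denotes a random variable with mass function $i\mapsto(1-p)p^i$, $i\in\mathbb{Z}_+$. A $\mathbb{Z}_+$-valued random variable $Y$ with mass function $p_Y$ is log-concave if $p_Y(i)^2\ge p_Y(i-1)p_Y(i+1)$ for all $i\ge1$. For a $\mathbb{Z}_+$-valued random variable $V$, $\mathcal{C}_V$ denotes the set of $\mathbb{Z}_+$-valued random variables $W$ independent of $V$ such that $V+W$ is log-concave (a property depending only on the distributions of $V$ and $W$). Thus $X\in\mathcal{C}_{\mathrm{Geom}(p)}$ means that the sum of $X$ and an independent $\mathrm{Geom}(p)$ random variable is log-concave. *)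

(* Defs.v *)
From HB Require Import structures.
From mathcomp Require Import all_boot all_order all_algebra.
From mathcomp Require Import all_classical all_reals all_analysis.

Set Implicit Arguments.
Unset Strict Implicit.
Unset Printing Implicit Defensive.

Import Order.TTheory GRing.Theory Num.Theory.
Import numFieldNormedType.Exports.

Local Open Scope classical_set_scope.
Local Open Scope ring_scope.

Definition geom_pmf {R : realType} (p : R) (k : nat) : R := (1 - p) * p ^+ k.

(* Outside 0 < p < 1 the value is a dummy, so that geom_prob p is always a
   probability measure. *)
Definition geom_prob {R : realType} (p : R) : set nat -> \bar R :=
  fun U => if 0 < p < 1 then \esum_(k in U) (geom_pmf p k)%:E else \d_0%N U.

Section geometric.
Context {R : realType} (p : R).
Local Open Scope ereal_scope.

Lemma geom_pmf_ge0 k : (0 < p < 1)%R -> 0 <= (geom_pmf p k)%:E.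
Proof.
by case/andP=> p0 p1; rewrite lee_fin mulr_ge0 ?subr_ge0 ?exprn_ge0 ?ltW.
Qed.

Let geom0 : geom_prob p set0 = 0.
Proof. by rewrite /geom_prob measure0; case: ifPn => //; rewrite esum_set0. Qed.

Let geom_ge0 U : 0 <= geom_prob p U.
Proof.
rewrite /geom_prob; case: ifPn => // p01; apply: esum_ge0 => /= n _.
exact: geom_pmf_ge0.
Qed.

Let geom_sigma_additive : semi_sigma_additive (geom_prob p).
Proof.
move=> F mF tF mUF; rewrite /geom_prob; case: ifPn => p01; last first.
  exact: measure_semi_sigma_additive.
apply: cvg_toP.
  apply: ereal_nondecreasing_is_cvgn => a b ab.
  apply: lee_sum_nneg_natr => // n _ _.
  by apply: esum_ge0 => /= ? _; exact: geom_pmf_ge0.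
by rewrite nneseries_sum_bigcup// => i; exact: geom_pmf_ge0.
Qed.

HB.instance Definition _ := isMeasure.Build _ _ _ (geom_prob p)
  geom0 geom_ge0 geom_sigma_additive.

Let geom_setT : geom_prob p [set: nat] = 1.
Proof.
rewrite /geom_prob; case: ifPn => [p01|_]; last by rewrite probability_setT.
rewrite -nneseries_esumT; last by move=> *; exact: geom_pmf_ge0.
have /andP[p0 p1] := p01.
have : series (geometric (1 - p)%R p) @ \oo --> (1 : R)%R.
  have := @cvg_geometric_series R (1 - p)%R p.
  rewrite ger0_norm ?ltW// mulfV ?subr_eq0 ?gt_eqF//; exact.
move=> h; apply/cvg_lim => //.
have -> : (fun n => \sum_(0 <= k < n) (geom_pmf p k)%:E) =
    EFin \o series (geometric (1 - p)%R p).
  by apply/funext => n /=; rewrite /series/= -sumEFin.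
by apply: cvg_EFin h; exact: nearW.
Qed.

HB.instance Definition _ :=
  @Measure_isProbability.Build _ _ R (geom_prob p) geom_setT.

End geometric.

Section nat_random_variables.
Context d (T : measurableType d) (R : realType) (P : probability T R).

Definition nat_pmf (Y : {RV P >-> nat}) (i : nat) : R :=
  fine (P (Y @^-1` [set i])).

Definition log_concave (Y : {RV P >-> nat}) : Prop :=
  forall i, (1 <= i)%N -> nat_pmf Y i.-1 * nat_pmf Y i.+1 <= nat_pmf Y i ^+ 2.

Definition independent_RV (V W : {RV P >-> nat}) : Prop :=
  forall A B : set nat, measurable A -> measurable B ->
  (P (V @^-1` A `&` W @^-1` B) = P (V @^-1` A) * P (W @^-1` B))%E.

Definition has_law (mu : probability nat R) (Y : {RV P >-> nat}) : Prop :=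
  forall A : set nat, measurable A -> distribution P Y A = mu A.

Definition add_RV (V W : {RV P >-> nat}) : T -> nat :=
  fun t => (V t + W t)%N.

Section add_RV_measurable.
Variables V W : {RV P >-> nat}.

Lemma add_RV_preimage n : add_RV V W @^-1` [set n] =
  \big[setU/set0]_(k < n.+1) (V @^-1` [set (k : nat)] `&` W @^-1` [set (n - k)%N]).
Proof.
rewrite -(bigcup_mkord n.+1
  (fun k => V @^-1` [set k] `&` W @^-1` [set (n - k)%N])).
apply/seteqP; split=> t /=; rewrite /add_RV.
  by move=> <-; exists (V t); rewrite /= ?ltnS ?leq_addr// addKn; split.
by case=> k /= kn [-> ->]; rewrite subnKC.
Qed.

Lemma measurable_add_RV : measurable_fun [set: T] (add_RV V W).
Proof.
move=> _ B _; rewrite setTI.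
have -> : add_RV V W @^-1` B = \bigcup_(n in B) (add_RV V W @^-1` [set n]).
  apply/seteqP; split => [t Bt|t [n Bn /= tn]]; first by exists (add_RV V W t).
  by rewrite /preimage/= tn.
apply: bigcup_measurable => n _; rewrite add_RV_preimage.
by apply: bigsetU_measurable => k _; apply: measurableI;
  exact: measurable_funPTI.
Qed.

HB.instance Definition _ :=
  isMeasurableFun.Build _ _ _ _ (add_RV V W) measurable_add_RV.

End add_RV_measurable.

End nat_random_variables.

Arguments nat_pmf {d T R} P Y i.
Arguments log_concave {d T R} P Y.
Arguments independent_RV {d T R} P V W.
Arguments has_law {d T R} P mu Y.
Arguments add_RV {d T R} P V W.

(* X belongs to C_V, where V has law mu.  Since X and V need not live on a
   common probability space, membership is stated for an independent pair
   (V, W) with laws mu and the law of X; see logconcave_classP for the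
   independence of the choice of such a pair. *)
Definition logconcave_class (R : realType) (mu : probability nat R)
    d (T : measurableType d) (P : probability T R) (X : {RV P >-> nat}) : Prop :=
  exists (d' : measure_display) (T' : measurableType d')
    (Q : probability T' R) (V W : {RV Q >-> nat}),
  [/\ has_law Q mu V, has_law Q (distribution P X) W, independent_RV Q V W
    & log_concave Q (add_RV Q V W)].

Arguments logconcave_class {R} mu {d T} P X.

Lemma nat_pmf_add_RV (R : realType) (mu nu : probability nat R)
    d (T : measurableType d) (Q : probability T R) (V W : {RV Q >-> nat}) n :
  has_law Q mu V -> has_law Q nu W -> independent_RV Q V W ->
  nat_pmf Q (add_RV Q V W) n =
  fine (\sum_(k < n.+1) mu [set (k : nat)] * nu [set (n - k)%N])%E.
Proof.
move=> hV hW VW; rewrite /nat_pmf /= add_RV_preimage measure_bigsetU_ord.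
- congr fine; apply: eq_bigr => k _.
  rewrite -(hV [set (k : nat)])// -(hW [set (n - k)%N])//.
  exact: VW.
- by move=> k; apply: measurableI; exact: measurable_funPTI.
- by move=> i j _ _ [t /= [[Vi _] [Vj _]]]; apply/val_inj; rewrite /= -Vi -Vj.
Qed.

Lemma logconcave_classP (R : realType) (mu : probability nat R)
    d (T : measurableType d) (P : probability T R) (X : {RV P >-> nat})
    d' (T' : measurableType d') (Q : probability T' R) (V W : {RV Q >-> nat}) :
  has_law Q mu V -> has_law Q (distribution P X) W -> independent_RV Q V W ->
  logconcave_class mu P X <-> log_concave Q (add_RV Q V W).
Proof.
move=> hV hW VW; split=> [|lc]; last by exists d', T', Q, V, W.
case=> [d1 [T1 [Q1 [V1 [W1 [hV1 hW1 VW1 lc]]]]]] i i1.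
by have := lc i i1; rewrite !(nat_pmf_add_RV _ hV1 hW1 VW1)
  !(nat_pmf_add_RV _ hV hW VW).
Qed.

(* Main.v *)
From HB Require Import structures.
Require Import Defs.
From mathcomp Require Import all_boot all_order all_algebra.
From mathcomp Require Import all_classical all_reals all_analysis.
From mathcomp Require Import ring.
Import Order.TTheory GRing.Theory Num.Theory.
Local Open Scope ring_scope.

(** Write [x] for the mass function of [X] and [s] for that of the sum of [X]
    and an independent geometric variable [V] of parameter [p].  Since the law
    of [V] is a geometric progression, [s] obeys the first-order recurrence
    [s (n+1) = p * s n + (1 - p) * x (n+1)] ([geom_convS]).  Substituting it
    twice linearizes the log-concavity defect ([geom_conv_defect]):
    [s (n+1) ^ 2 - s n * s (n+2)
       = (1 - p) * (s (n+1) * x (n+1) - s n * x (n+2))].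

    If [x (n+2) <= p * x (n+1)], the right-hand side is nonnegative because
    [p * s n <= s (n+1)].  If instead [x (n+1) = 0] while [x n] and [x (n+2)]
    are positive, the first product vanishes and the second does not, since
    [s n >= (1 - p) * x n > 0]; the defect is then negative.

    Membership in the class asks for an independent pair with the prescribed
    marginals; the two projections of the product space provide one
    ([exists_independent_pair]). *)

(** The mass function of [V + X] for [V] geometric of parameter [p] and [X]
    independent of mass function [x]. *)
Definition geom_conv {R : realType} (p : R) (x : nat -> R) (n : nat) : R :=
  \sum_(k < n.+1) geom_pmf p k * x (n - k)%N.

Section geometric_convolution.
Context {R : realType} (p : R) (x : nat -> R).

(** Splitting off the term [V = 0] leaves [p] times the previous sum, because
    consecutive geometric weights have ratio [p]. *)
Lemma geom_convS n :
  geom_conv p x n.+1 = p * geom_conv p x n + (1 - p) * x n.+1.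
Proof.
rewrite /geom_conv big_ord_recl subn0 {1}/geom_pmf expr0 mulr1 addrC.
congr (_ + _); rewrite mulr_sumr; apply: eq_bigr => k _.
by rewrite /= /bump /= subSS /geom_pmf exprS; ring.
Qed.

Lemma geom_conv_defect n :
  geom_conv p x n.+1 ^+ 2 - geom_conv p x n * geom_conv p x n.+2 =
  (1 - p) * (geom_conv p x n.+1 * x n.+1 - geom_conv p x n * x n.+2).
Proof. by rewrite (geom_convS n.+1) (geom_convS n); ring. Qed.

Hypotheses (p01 : 0 < p < 1) (x_ge0 : forall n, 0 <= x n).

Lemma geom_conv_ge n : (1 - p) * x n <= geom_conv p x n.
Proof.
rewrite /geom_conv big_ord_recl subn0 {1}/geom_pmf expr0 mulr1 lerDl.
apply: sumr_ge0 => k _; apply: mulr_ge0 => //.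
by have := geom_pmf_ge0 (lift ord0 k) p01; rewrite lee_fin.
Qed.

Lemma geom_conv_ge0 n : 0 <= geom_conv p x n.
Proof.
apply: le_trans (geom_conv_ge n); have /andP[_ p1] := p01.
by rewrite mulr_ge0// subr_ge0 ltW.
Qed.

Lemma geom_conv_log_concave n : x n.+2 <= p * x n.+1 ->
  geom_conv p x n * geom_conv p x n.+2 <= geom_conv p x n.+1 ^+ 2.
Proof.
move=> x_ratio; have /andP[p0 p1] := p01.
rewrite -subr_ge0 geom_conv_defect mulr_ge0 ?subr_ge0 ?(ltW p1)//.
apply: le_trans (ler_wpM2l (geom_conv_ge0 n) x_ratio) _.
rewrite mulrA [geom_conv _ _ n * p]mulrC ler_wpM2r// geom_convS lerDl.
by rewrite mulr_ge0// subr_ge0 ltW.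
Qed.

Lemma geom_conv_gap n : 0 < x n -> x n.+1 = 0 -> 0 < x n.+2 ->
  geom_conv p x n.+1 ^+ 2 < geom_conv p x n * geom_conv p x n.+2.
Proof.
move=> xn xn1 xn2; have /andP[p0 p1] := p01.
have sn : 0 < geom_conv p x n.
  by apply: lt_le_trans (geom_conv_ge n); rewrite mulr_gt0 ?subr_gt0.
rewrite -subr_lt0 geom_conv_defect xn1 mulr0 sub0r mulrN oppr_lt0.
by rewrite !mulr_gt0 ?subr_gt0.
Qed.

End geometric_convolution.

Lemma geom_prob_set1 {R : realType} (p : R) (k : nat) : 0 < p < 1 ->
  geom_prob p [set k]%classic = (geom_pmf p k)%:E.
Proof. by move=> p01; rewrite /geom_prob p01 esum_set1// geom_pmf_ge0. Qed.

Lemma nat_pmf_add_geom {R : realType} {p : R}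
    {d} {T : measurableType d} {P : probability T R} {X : {RV P >-> nat}}
    {d'} {T' : measurableType d'} {Q : probability T' R} {V W : {RV Q >-> nat}}
    {n : nat} :
  0 < p < 1 -> has_law Q (geom_prob p) V -> has_law Q (distribution P X) W ->
  independent_RV Q V W ->
  nat_pmf Q (add_RV Q V W) n = geom_conv p (nat_pmf P X) n.
Proof.
move=> p01 hV hW VW; rewrite (nat_pmf_add_RV _ hV hW VW) /geom_conv.
under eq_bigr => k _.
  rewrite [X in (X * _)%E]geom_prob_set1// -[X in (_ * X)%E]fineK.
    rewrite -EFinM; over.
  exact: fin_num_measure.
by rewrite sumEFin.
Qed.

(** The product measure of a rectangle is the product of the masses of its
    sides, which for the two projections is exactly independence. *)
Lemma exists_independent_pair {R : realType} (mu nu : probability nat R) :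
  exists (d : measure_display) (T : measurableType d) (Q : probability T R)
    (V W : {RV Q >-> nat}),
  [/\ has_law Q mu V, has_law Q nu W & independent_RV Q V W].
Proof.
pose Q : probability (nat * nat)%type R := (mu \x nu)%E.
have QE A B : measurable A -> measurable B ->
    Q (A `*` B)%classic = (mu A * nu B)%E.
  exact: product_measure1E.
pose V : {RV Q >-> nat} :=
  HB.pack fst (isMeasurableFun.Build _ _ _ _ _ measurable_fst).
pose W : {RV Q >-> nat} :=
  HB.pack snd (isMeasurableFun.Build _ _ _ _ _ measurable_snd).
have VE (A : set nat) : (V @^-1` A = A `*` setT)%classic.
  by apply/seteqP; split=> -[a b] // -[].
have WE (A : set nat) : (W @^-1` A = setT `*` A)%classic.
  by apply/seteqP; split=> -[a b] // -[].
have hV : has_law Q mu V.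
  move=> A mA; rewrite /distribution/= /pushforward.
  by rewrite VE QE// probability_setT mule1.
have hW : has_law Q nu W.
  move=> A mA; rewrite /distribution/= /pushforward.
  by rewrite WE QE// probability_setT mul1e.
exists _, _, Q, V, W; split => // A B mA mB.
rewrite -[X in _ = (X * _)%E]/(distribution Q V A) hV//.
rewrite -[X in _ = (_ * X)%E]/(distribution Q W B) hW//.
by rewrite -QE.
Qed.

Theorem lemma4p3 (R : realType) (d : measure_display) (T : measurableType d)
    (P : probability T R) (X : {RV P >-> nat}) :
  (forall p : R, 0 < p < 1 ->
     (forall i : nat, (1 <= i)%N -> nat_pmf P X i.+1 <= p * nat_pmf P X i) ->
     logconcave_class (geom_prob p) P X) /\
  ((exists i : nat, [/\ (1 <= i)%N, nat_pmf P X i = 0,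
       0 < nat_pmf P X i.-1 & 0 < nat_pmf P X i.+1]) ->
   forall p : R, 0 < p < 1 -> ~ logconcave_class (geom_prob p) P X).
Proof.
have pmf_ge0 n : 0 <= nat_pmf P X n by exact: fine_ge0.
split=> [p p01 ratio|[[|n] [// _ xn1 xn xn2]] p p01].
  have [d' [T' [Q [V [W [hV hW VW]]]]]] :=
    exists_independent_pair (geom_prob p) (distribution P X).
  exists d', T', Q, V, W; split => // -[//|n] _.
  rewrite !(nat_pmf_add_geom p01 hV hW VW).
  by apply: geom_conv_log_concave => //; exact: ratio.
case=> [d' [T' [Q [V [W [hV hW VW /(_ n.+1 isT)]]]]]].
rewrite !(nat_pmf_add_geom p01 hV hW VW).
by apply/negP; rewrite -ltNge; exact: geom_conv_gap.
Qed.
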